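(* Let $p,q,r$ be positive integers. Let $C_p$ act on $C_q$ with a generator acting as multiplication by $\phi$, where $\phi$ is an integer coprime to $q$, and assume that $\phi$ has (multiplicative) order $p$ modulo $q$ and that $\phi-1$ and $\phi+1$ are both coprime to $q$. Then for $p\mid r$, the group $G=C_q\rtimes C_{pr}$, where a generator of $C_{pr}$ acts on $C_q$ as multiplication by $\phi$, is chiral with the word $$w=a^p[a,b][a^{-1},b]^{\phi},$$ that is, the pair $(G,w)$ is chiral.
   Context: $C_n$ denotes the cyclic group of order $n$ ($C_q$ is written additively as $\mathbb{Z}/q$). $[x,y]=x^{-1}y^{-1}xy$; in $w$ the symbols $a,b$ are the variables and the exponent $\phi$ is the integer $\phi$. A word $w$ in $k$ variables is an element of the free group on $k$ symbols. For a group $G$, $w$ induces by evaluation a map $w:G^{(k)}\to G$, where $G^{(k)}$ is the direct product of $k$ copies of $G$; its image is denoted $G_w$ (not assumed closed under inverses). A pair $(G,w)$ is chiral if $G_w\neq G_{w^{-1}}$, equivalently if the set of inverses of elements of $G_w$ is not equal to $G_w$. A group $G$ is chiral if $(G,w)$ is chiral for some word $w$.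
   Formalization: The formal statement requires q > 1 instead of q positive: for q = 1 one has p = 1, G = C_r is abelian and w evaluates to a, so G_w = G = G_{w^{-1}} and (G,w) is not chiral. *)

(* Defs.v *)
From HB Require Import structures.
From mathcomp Require Import all_boot all_order all_algebra all_fingroup all_solvable.

Set Implicit Arguments.
Unset Strict Implicit.
Unset Printing Implicit Defensive.

Local Open Scope group_scope.

(* The letter (i, false) stands for the i-th symbol of the alphabet and        *)
(* (i, true) for its formal inverse.                                           *)
Definition letter (k : nat) : Type := ('I_k * bool)%type.

Definition inv_letter (k : nat) (x : letter k) : letter k := (x.1, ~~ x.2).

Definition reduced (k : nat) (s : seq (letter k)) : bool :=
  sorted (fun x y => y != inv_letter x) s.

(* The free group on k symbols, realized as the reduced words.                 *)
Record free_group (k : nat) : Type :=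
  FreeGroup { letters :> seq (letter k); _ : reduced letters }.

HB.instance Definition _ k := [isSub for @letters k].
HB.instance Definition _ k := [Choice of free_group k by <:].

(* Left multiplication of a reduced word by a letter. *)
Definition push (k : nat) (x : letter k) (s : seq (letter k)) :
    seq (letter k) :=
  if s is y :: s' then if y == inv_letter x then s' else x :: s else [:: x].

Lemma inv_letterK k : involutive (@inv_letter k).
Proof. by case=> i b; rewrite /inv_letter /= negbK. Qed.

Lemma reduced_behead k (x : letter k) s : reduced (x :: s) -> reduced s.
Proof. by rewrite /reduced; case: s => //= y s /andP[]. Qed.

Lemma push_reduced k (x : letter k) s : reduced s -> reduced (push x s).
Proof.
case: s => //= y s red_ys; case: ifP => [_|ne]; first exact: reduced_behead red_ys.
by rewrite /reduced /= ne.
Qed.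

Lemma pushK k (x : letter k) s : reduced s -> push (inv_letter x) (push x s) = s.
Proof.
case: s => [|y s] /=; first by rewrite inv_letterK eqxx.
case: eqP => [->|_ _] /=; last by rewrite inv_letterK eqxx.
by case: s => //= z s /andP[/negPf ->].
Qed.

Lemma foldr_push_reduced k (s t : seq (letter k)) :
  reduced t -> reduced (foldr (@push k) t s).
Proof. by move=> red_t; elim: s => //= x s IHs; apply: push_reduced. Qed.

Lemma foldr_push_nil k (s : seq (letter k)) :
  reduced s -> foldr (@push k) [::] s = s.
Proof.
elim: s => //= x s IHs red_xs; rewrite IHs ?(reduced_behead red_xs) //.
by case: s red_xs {IHs} => //= y s /andP[/negPf ->].
Qed.

Lemma foldr_push_push k (x : letter k) (s t : seq (letter k)) : reduced t ->
  foldr (@push k) t (push x s) = push x (foldr (@push k) t s).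
Proof.
move=> red_t; case: s => //= y s; case: eqP => //= ->.
have:= @pushK k (inv_letter x) _ (foldr_push_reduced s red_t).
by rewrite inv_letterK => ->.
Qed.

Definition inv_word (k : nat) (s : seq (letter k)) : seq (letter k) :=
  rev (map (@inv_letter k) s).

Lemma inv_wordK k : involutive (@inv_word k).
Proof.
move=> s; rewrite /inv_word map_rev revK -map_comp map_id_in // => x _.
exact: inv_letterK.
Qed.

Lemma inv_word_reduced k (s : seq (letter k)) : reduced s -> reduced (inv_word s).
Proof.
rewrite /reduced /inv_word rev_sorted sorted_map; apply: sub_sorted => x y.
rewrite /= (can_eq (@inv_letterK k)) [x == _]eq_sym.
by rewrite (can2_eq (@inv_letterK k) (@inv_letterK k)).
Qed.

Lemma foldr_push_inv k (s : seq (letter k)) :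
  reduced s -> foldr (@push k) s (inv_word s) = [::].
Proof.
rewrite /inv_word; elim: s => //= x s IHs red_xs.
rewrite rev_cons foldr_rcons /= inv_letterK eqxx IHs //.
exact: reduced_behead red_xs.
Qed.

Section FreeGroupType.
Variable k : nat.
Implicit Types u v : free_group k.

Definition fg_one : free_group k := FreeGroup (isT : reduced [::]).
Definition fg_mul u v : free_group k :=
  FreeGroup (@foldr_push_reduced k u v (valP v)).
Definition fg_inv u : free_group k := FreeGroup (inv_word_reduced (valP u)).

Lemma fg_mulA : associative fg_mul.
Proof.
move=> u v w; apply/val_inj; rewrite /= -!/(letters _).
have red_w : reduced w by apply: (valP w).
elim: (letters u) => //= x s ->; by rewrite foldr_push_push.
Qed.

Lemma fg_mul1 : left_id fg_one fg_mul.
Proof. by move=> u; apply/val_inj. Qed.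

Lemma fg_mulr1 : right_id fg_one fg_mul.
Proof. by move=> u; apply/val_inj/foldr_push_nil/(valP u). Qed.

Lemma fg_mulV : left_inverse fg_one fg_inv fg_mul.
Proof. by move=> u; apply/val_inj/foldr_push_inv/(valP u). Qed.

Lemma fg_mulrV : right_inverse fg_one fg_inv fg_mul.
Proof.
move=> u; apply/val_inj.
have := foldr_push_inv (inv_word_reduced (valP u)).
by rewrite inv_wordK.
Qed.

HB.instance Definition _ :=
  isGroup.Build (free_group k) fg_mulA fg_mul1 fg_mulr1 fg_mulV fg_mulrV.

End FreeGroupType.

Definition fg_gen (k : nat) (i : 'I_k) : free_group k :=
  FreeGroup (isT : reduced [:: (i, false)]).

(* The library only has natural exponents in groups. *)
Definition expgz (G : groupType) (x : G) (n : int) : G :=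
  match n with Posz m => x ^+ m | Negz m => x ^- m.+1 end.

Section WordMap.
Variables (G : groupType) (k : nat).

Definition eval_letter (g : G ^ k) (x : letter k) : G :=
  if x.2 then (g x.1)^-1 else g x.1.

(* The map G^(k) -> G induced by w. *)
Definition word_map (w : free_group k) (g : G ^ k) : G :=
  \prod_(x <- letters w) eval_letter g x.

(* The set G_w. *)
Definition word_image (w : free_group k) (x : G) : Prop :=
  exists g : G ^ k, word_map w g = x.

Lemma eval_inv_letter g x : eval_letter g (inv_letter x) = (eval_letter g x)^-1.
Proof. by case: x => i [] //=; rewrite /eval_letter /= invgK. Qed.

Lemma word_map_gen i g : word_map (fg_gen i) g = g i.
Proof. exact: big_seq1. Qed.

Lemma word_mapM u v g : word_map (u * v) g = word_map u g * word_map v g.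
Proof.
rewrite /word_map -[letters (u * v)]/(foldr (@push k) (letters v) (letters u)).
elim: (letters u) => [|x s IHs] /=; first by rewrite big_nil mul1g.
rewrite big_cons -mulgA -IHs; case: foldr => [|y t] /=.
  by rewrite big_seq1 big_nil mulg1.
case: eqP => [->|_]; last by rewrite !big_cons.
by rewrite big_cons eval_inv_letter mulVKg.
Qed.

Lemma word_mapV u g : word_map u^-1 g = (word_map u g)^-1.
Proof.
apply: (mulgI (word_map u g)).
by rewrite -word_mapM !mulgV /word_map big_nil.
Qed.

End WordMap.

(* G_w <> G_{w^-1}; w^-1 is the inverse in the free group. *)
Definition chiral_pair (G : groupType) (k : nat) (w : free_group k) : Prop :=
  ~ (forall x : G, word_image w x <-> word_image w^-1 x).

(* The library's [~ x, y] is x^-1 y^-1 x y. *)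
Definition metacyclic_word (p : nat) (phi : int) : free_group 2 :=
  let a := fg_gen (ord0 : 'I_2) in
  let b := fg_gen (ord_max : 'I_2) in
  a ^+ p * [~ a, b] * expgz [~ a^-1, b] phi.

(* Semidirect products 'Z_q ><| 'Z_n with a generator of 'Z_n acting as        *)
(* multiplication by phi do exist when phi^n = 1 in 'Z_q and n > 1.            *)
Lemma mul_action_exists (n q : nat) (phi : 'Z_q) : (1 < n)%N ->
  (phi ^+ n = 1)%R ->
  exists to : groupAction [set: 'Z_n] [set: 'Z_q],
    forall x : 'Z_q, to x (1%R : 'Z_n) = (phi * x)%R.
Proof.
move=> n_gt1 phi_n.
pose f (x : 'Z_q) (i : 'Z_n) : 'Z_q := (phi ^+ i * x)%R.
have phi_modn m : (phi ^+ (m %% (Zp_trunc n).+2) = phi ^+ m)%R.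
  by rewrite Zp_cast // GRing.expr_mod.
have fM x : act_morph f x.
  move=> i j; rewrite /f GRing.mulrA -GRing.exprD -[RHS]/(_ * _)%R.
  by congr (_ * _)%R; rewrite /= phi_modn addnC.
have f1 x : f x 1 = x by rewrite /f GRing.expr0 GRing.mul1r.
pose to := TotalAction f1 fM.
have toA : is_groupAction [set: 'Z_q] (to : action [set: 'Z_n] 'Z_q).
  move=> i _; rewrite inE; apply/andP; split.
    by apply/subsetP=> x _; rewrite inE.
  by apply/morphicP=> x y _ _; rewrite !actpermE /= /f; exact: GRing.mulrDr.
exists (GroupAction toA) => x /=; rewrite /f.
suff -> : ((1%R : 'Z_n) : nat) = 1%N by rewrite GRing.expr1.
by rewrite /= modn_small.
Qed.

(* Main.v *)
Require Import Defs.
From mathcomp Require Import all_boot all_order all_algebra all_fingroup all_solvable.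
From mathcomp Require Import ring.

(** Elements of the semidirect product are pairs (a, x), with a in the acting
group and x in 'Z_q, and a acts by multiplication by a unit [multiplier a].
The word w = a^p [a, b] [a^-1, b]^phi evaluates at the pairs (a, x), (b, y),
where alpha and beta are the multipliers of a and b, to
<<
  (a^p, (1 + alpha + ... + alpha^(p-1)) x
          + (1 - phi / alpha) ((beta - 1) x + (1 - alpha) y))
>>
([word_map_metacyclic]).  Both coefficients vanish when alpha = phi: the first
since phi^p = 1 and phi - 1 is a unit, the second trivially.

Look now at the fibres of G_w above t^p and t^-p, with t the generator of the
acting group whose multiplier is phi.  If a^p = t^p, then a = t^k with
k = 1 mod r, hence mod p, because p divides r; so alpha = phi, and (t^p, 0) is
the only element of G_w above t^p.  On the other side, a = t^-1, x = 0, b = 1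
gives (t^-p, (1 - phi^2) (1 - phi^-1) y), whose second coefficient is a unit
because phi and phi +/- 1 are; hence (t^-p, 1) is in G_w.  Its inverse
(t^p, -1) lies in the image of w^-1 but not in G_w. *)

Set Implicit Arguments.
Unset Strict Implicit.
Unset Printing Implicit Defensive.

Import GRing.Theory.
Local Open Scope ring_scope.

Lemma intr_Zp_unit (q : nat) (z : int) : (1 < q)%N -> coprimez z q%:Z ->
  (z%:~R : 'Z_q) \is a GRing.unit.
Proof.
move=> q_gt1; rewrite coprimezE => co_z.
rewrite [z]intEsign rmorphM rmorph_sign unitrMl ?unitrX ?unitrN1 //.
by rewrite unitZpE // coprime_sym.
Qed.

Section WordEvaluation.

Variables (G : groupType) (k : nat) (g : G ^ k).
Implicit Types u v : free_group k.

Lemma word_map_exp u n : word_map (u ^+ n)%g g = (word_map u g ^+ n)%g.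
Proof.
elim: n => [|n IHn]; first by rewrite /word_map big_nil.
by rewrite !expgS word_mapM IHn.
Qed.

Lemma word_map_expgz u n : word_map (expgz u n) g = expgz (word_map u g) n.
Proof. by case: n => n /=; rewrite ?word_mapV word_map_exp. Qed.

Lemma word_map_comm u v :
  word_map [~ u, v]%g g = [~ word_map u g, word_map v g]%g.
Proof. by rewrite /commg /conjg !word_mapM !word_mapV. Qed.

End WordEvaluation.

Section CyclicKernel.

Variables (aT : finGroupType) (q : nat).
Variable to : groupAction [set: aT] [set: 'Z_q].
Implicit Types (a b : aT) (x y : 'Z_q) (u v : sdprod_by to).

(** The group 'Z_q is cyclic, generated by 1, so an automorphism of it is
multiplication by the image of 1. *)
Definition multiplier a : 'Z_q := to 1 a.

Lemma act_multiplier x a : to x a = multiplier a * x.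
Proof.
have -> : x = ((1%R : 'Z_q) ^+ x)%g by rewrite FinRing.zmodXgE natr_Zp.
by rewrite gactX ?inE // !FinRing.zmodXgE natr_Zp -mulr_natr natr_Zp.
Qed.

Lemma multiplier1 : multiplier 1%g = 1.
Proof. exact: act1. Qed.

Lemma multiplierM a b : multiplier (a * b)%g = multiplier a * multiplier b.
Proof. by rewrite {1}/multiplier actMin ?inE // !act_multiplier mulr1 mulrC. Qed.

Lemma multiplierX a n : multiplier (a ^+ n)%g = multiplier a ^+ n.
Proof.
by elim: n => [|n IHn]; rewrite ?multiplier1 // expgS multiplierM IHn exprS.
Qed.

Lemma multiplier_unit a : multiplier a \is a GRing.unit.
Proof.
apply/unitrP; exists (multiplier a^-1%g).
by rewrite -!multiplierM mulgV mulVg multiplier1.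
Qed.

Lemma multiplierV a : multiplier a^-1%g = (multiplier a)^-1.
Proof.
apply: (mulrI (multiplier_unit a)).
by rewrite -multiplierM mulgV multiplier1 mulrV ?multiplier_unit.
Qed.

Lemma sd_mulE u v :
  (u * v)%g = ((u.1 * v.1)%g, multiplier v.1 * u.2 + v.2) :> _ * _.
Proof. by rewrite -act_multiplier. Qed.

Lemma sd_pair1E x : sdpair1 to x = (1%g, x) :> _ * _.
Proof. by rewrite val_insubd !inE. Qed.

Lemma sd_expE u n :
  (u ^+ n)%g = ((u.1 ^+ n)%g, (\sum_(i < n) multiplier u.1 ^+ i) * u.2) :> _ * _.
Proof.
elim: n => [|n IHn]; first by rewrite big_ord0 mul0r.
rewrite expgSr sd_mulE IHn /= -expgSr big_ord_recl expr0; congr pair.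
rewrite mulrDl mul1r addrC mulrA big_distrr /=.
by congr (_ + _ * _); apply: eq_bigr => i _; rewrite exprS.
Qed.

(** As u v = v u [u, v], the second coordinate of the commutator is the
difference of those of u v and v u: no inverse has to be computed. *)
Lemma sd_commE u v : commute u.1 v.1 ->
  [~ u, v]%g
    = sdpair1 to ((multiplier v.1 - 1) * u.2 + (1 - multiplier u.1) * v.2)%R.
Proof.
move=> cuv; apply: (mulgI (v * u)%g).
rewrite -commgC; apply: val_inj; rewrite -[LHS]/(pair_of_sd _) -[RHS]/(pair_of_sd _).
rewrite !(sd_mulE, sd_pair1E) /= mulg1 cuv multiplier1; congr pair; ring.
Qed.

Lemma sd_invE u : (u^-1)%g = ((u.1^-1)%g, - ((multiplier u.1)^-1 * u.2)) :> _ * _.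
Proof. by rewrite -multiplierV -mulrN -act_multiplier. Qed.

Lemma sd_expgz_pair1 x n : expgz (sdpair1 to x) n = sdpair1 to (n%:~R * x)%R.
Proof.
have eX m : (sdpair1 to x ^+ m)%g = sdpair1 to (m%:R * x)%R.
  rewrite -morphX ?inE //; congr sdpair1.
  by rewrite FinRing.zmodXgE mulr_natl.
case: n => m /=; rewrite eX // NegzE mulrNz mulNr.
by rewrite -morphV ?inE.
Qed.

(** Both commutators lie in the kernel of the projection to the acting group,
and the second is - (multiplier u.1)^-1 times the first; this is what produces
the factor 1 - phi / multiplier u.1, which vanishes exactly when the multiplier
of u.1 is phi. *)
Lemma word_map_metacyclic p phi (g : sdprod_by to ^ 2)
    (u := g ord0) (v := g ord_max) : commute u.1 v.1 ->
  word_map (metacyclic_word p phi) g =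
    ((u.1 ^+ p)%g,
     (\sum_(i < p) multiplier u.1 ^+ i) * u.2
     + (1 - phi%:~R * (multiplier u.1)^-1)
       * ((multiplier v.1 - 1) * u.2 + (1 - multiplier u.1) * v.2)) :> _ * _.
Proof.
move=> cuv; have cVuv : commute (u^-1)%g.1 v.1.
  by apply: commute_sym; apply: commuteV.
rewrite /metacyclic_word 2!word_mapM word_map_exp word_map_expgz.
rewrite !word_map_comm word_mapV !word_map_gen -/u -/v !sd_commE //.
rewrite sd_expgz_pair1 !(sd_mulE, sd_pair1E, sd_expE, sd_invE) /= !mulg1.
rewrite multiplier1 !mul1r -addrA multiplierV; congr (_, _ + _).
have /mulrV := multiplier_unit u.1.
set a := multiplier u.1; set a' := a^-1; move: (multiplier v.1) => b aV.
have -> : 1 - a' = - (a' * (1 - a)).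
  by rewrite mulrBr mulr1 [a' * a]mulrC aV opprB.
ring.
Qed.

End CyclicKernel.

Theorem lemma4p2 (p q r : nat) (phi : int)
    (p_gt0 : (0 < p)%N) (q_gt1 : (1 < q)%N) (r_gt0 : (0 < r)%N)
    (co_phi : coprimez phi q%:Z)
    (ord_phi : p.-primitive_root (phi%:~R : 'Z_q))
    (co_phiB1 : coprimez (phi - 1) q%:Z)
    (co_phiD1 : coprimez (phi + 1) q%:Z)
    (p_dvd_r : (p %| r)%N)
    (to : groupAction [set: 'Z_(p * r)] [set: 'Z_q])
    (t : 'Z_(p * r)) (gen_t : generator [set: 'Z_(p * r)] t)
    (to_t : forall x : 'Z_q, to x t = phi%:~R * x) :
  chiral_pair (sdprod_by to) (metacyclic_word p phi).
Proof.
set f : 'Z_q := phi%:~R in ord_phi to_t.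
have f1_unit : f - 1 \is a GRing.unit.
  by have := intr_Zp_unit q_gt1 co_phiB1; rewrite rmorphB rmorph1.
have fD1_unit : f + 1 \is a GRing.unit.
  by have := intr_Zp_unit q_gt1 co_phiD1; rewrite rmorphD rmorph1.
have f_unit : f \is a GRing.unit := intr_Zp_unit q_gt1 co_phi.
have mult_t : multiplier to t = f by rewrite /multiplier to_t mulr1.
have sum0 : \sum_(i < p) f ^+ i = 0.
  by apply: (mulrI f1_unit); rewrite mulr0 -subrX1 prim_expr_order // subrr.
(* This excludes p = r = 1, where 'Z_(p * r) does not have p * r elements. *)
have p_neq1 : p != 1%N.
  apply: contraTneq f1_unit => p1; have := prim_expr_order ord_phi.
  by rewrite p1 expr1 => ->; rewrite subrr unitr0.
have pr_gt1 : (1 < p * r)%N.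
  by rewrite (leq_trans (_ : 1 < p)%N) ?leq_pmulr // ltn_neqAle eq_sym p_neq1.
have ord_t : #[t]%g = (p * r)%N.
  rewrite orderE -(eqP gen_t) cardsT card_ord Zp_cast //.
have root_t a : (a ^+ p)%g = (t ^+ p)%g -> multiplier to a = f.
  have /cycleP[k ->] : a \in <[t]>%g by rewrite -(eqP gen_t) inE.
  move=> /eqP; rewrite -expgM eq_expg_mod_order ord_t => /eqP eq_kp.
  have eq_k1 : k = 1 %[mod r].
    apply/eqP; rewrite -(eqn_pmul2l p_gt0) !muln_modr muln1 (mulnC p k).
    exact/eqP.
  rewrite multiplierX mult_t -(prim_expr_mod ord_phi) -(modn_dvdm k p_dvd_r).
  by rewrite eq_k1 modn_dvdm // prim_expr_mod.
have comm_all (a b : 'Z_(p * r)) : commute a b by apply: Zp_mulgC.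
(* The coefficient of y in the value of w at ((t^-1, 0), (1, y)). *)
pose d : 'Z_q := (1 - f * f) * (1 - f^-1).
have d_unit : d \is a GRing.unit.
  have dE1 : 1 - f * f = - (f - 1) * (f + 1) by ring.
  have dE2 : 1 - f^-1 = (f - 1) * f^-1 by rewrite mulrBl mulrV // mul1r.
  by rewrite /d dE1 dE2 !unitrM unitrN unitrV f1_unit fD1_unit f_unit.
pose g : sdprod_by to ^ 2 :=
  [ffun i : 'I_2 => if i == ord0 then sdpair2 to t^-1%g else sdpair1 to d^-1%R].
have wgE : word_map (metacyclic_word p phi) g = ((t^-1 ^+ p)%g, 1%R) :> _ * _.
  rewrite word_map_metacyclic; last exact: comm_all.
  rewrite !ffunE /= sd_pair1E val_insubd !inE /= multiplierV mult_t invrK.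
  by rewrite !mulr0 !add0r mulrA mulrV.
(* The inverse (t^p, -1) of the value at g should be in G_w as well. *)
move=> /(_ (word_map (metacyclic_word p phi) g)^-1%g)[_].
case; first by exists g; rewrite word_mapV.
have multtp : multiplier to (t ^- p)%g = 1.
  by rewrite multiplierV multiplierX mult_t prim_expr_order // invr1.
move=> h /(congr1 (@pair_of_sd _ _ _ _ to)).
rewrite word_map_metacyclic; last exact: comm_all.
rewrite sd_invE wgE [(_, _).1]/= [(_, _).2]/= expgVn invgK multtp invr1 mulr1.
case/pair_equal_spec=> /root_t-> /eqP.
by rewrite sum0 mul0r add0r mulrV // subrr mul0r eq_sym oppr_eq0 oner_eq0.
Qed.
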